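(* Let $n,m,p\ge 1$, let $\mathcal{U},\mathcal{W}\subset\mathbb{Z}$ be nonempty finite sets, and let $B\in\mathbb{Z}^{n\times m}$, $D\in\mathbb{Z}^{n\times p}$. Consider the system $x(t+1)=x(t)+Bu(t)-Dw(t)$, $t\in\mathbb{Z}_+$, with state $x(t)\in\mathbb{R}^n$, control input $u(t)\in\mathcal{U}^m$ and disturbance input $w(t)\in\mathcal{W}^p$. If $\mathcal{U}_z^*\neq\emptyset$ for all $z\in\mathbb{B}^n$, then there exists a hyperbox $X=[0,x_1^+]\times\cdots\times[0,x_n^+]$ that is both robustly control invariant and robustly globally attractive.
   Context: $\mathbb{Z}_+$ denotes the non-negative integers, $[x]_i$ the $i$-th component of a vector $x$, and $\mathbb{B}^n=\{0,1\}^n$. For $i\in\{1,\dots,n\}$ define $\mathcal{U}_{+*}^i=\{u\in\mathcal{U}^m : [Bu-Dw]_i> 0\ \forall w\in\mathcal{W}^p\}$ and $\mathcal{U}_{-*}^i=\{u\in\mathcal{U}^m : [Bu-Dw]_i< 0\ \forall w\in\mathcal{W}^p\}$. The signature of $x\in\mathbb{R}_+^n$ (non-negative entries) is the $n$-tuple $(s_1,\dots,s_n)$ with $s_i=+$ if $[x]_i=0$ and $s_i=-$ if $[x]_i>0$. For $x$ with signature $(s_1,\dots,s_n)$, $\mathcal{U}_x^*=\mathcal{U}_{s_1*}^1\cap\cdots\cap\mathcal{U}_{s_n*}^n$. A hyperbox is a set $X=[0,x_1^+]\times\cdots\times[0,x_n^+]\subset\mathbb{R}^n$ with real numbers $x_i^+\ge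 0$. $X$ is robustly control invariant if there exists a control law $\varphi:X\to\mathcal{U}^m$ such that for every $x\in X$ and every $w\in\mathcal{W}^p$, $x+B\varphi(x)-Dw\in X$. $X$ is robustly globally attractive if there exists a control law $\psi:\mathbb{R}^n\setminus X\to\mathcal{U}^m$ such that for every initial condition $x(0)\in\mathbb{R}^n\setminus X$ and every disturbance $w:\mathbb{Z}_+\to\mathcal{W}^p$, the corresponding state trajectory (given by $x(t+1)=x(t)+B\psi(x(t))-Dw(t)$ as long as $x(t)\in\mathbb{R}^n\setminus X$) satisfies $x(\tau)\in X$ for some $\tau\in\mathbb{Z}_+$. *)

(* Defs.v *)
From mathcomp Require Import all_boot all_order all_algebra.
From mathcomp Require Import finmap.
From mathcomp Require Import classical_sets functions reals.

Set Implicit Arguments.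
Unset Strict Implicit.
Unset Printing Implicit Defensive.

Import Order.TTheory GRing.Theory Num.Theory.

Local Open Scope classical_set_scope.
Local Open Scope ring_scope.

                                                          
Definition vectors_in (S : {fset int}) (k : nat) : set 'cV[int]_k :=
  [set v | forall j, v j ord0 \in S].

Inductive sign := Plus | Minus.

Section System.
Variables (R : realType) (n m p : nat) (U W : {fset int}).
Variables (B : 'M[int]_(n, m)) (D : 'M[int]_(n, p)).

Definition Ustar (s : sign) (i : 'I_n) : set 'cV[int]_m :=
  match s with
  | Plus => [set u | vectors_in U u /\
      forall w, vectors_in W w -> 0 < (B *m u - D *m w) i ord0]
  | Minus => [set u | vectors_in U u /\
      forall w, vectors_in W w -> (B *m u - D *m w) i ord0 < 0]
  end.

                                                               
Definition signature (x : 'cV[R]_n) (i : 'I_n) : sign :=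
  if x i ord0 == 0 then Plus else Minus.

Definition Ustar_of (x : 'cV[R]_n) : set 'cV[int]_m :=
  \bigcap_(i in [set: 'I_n]) Ustar (signature x i) i.

Definition binary_vectors : set 'cV[R]_n :=
  [set z | forall i, z i ord0 = 0 \/ z i ord0 = 1].

Definition is_hyperbox (X : set 'cV[R]_n) : Prop :=
  exists2 xplus : 'cV[R]_n, (forall i, 0 <= xplus i ord0) &
    X = [set x | forall i, 0 <= x i ord0 <= xplus i ord0].

Definition next_state (x : 'cV[R]_n) (u : 'cV[int]_m) (w : 'cV[int]_p) :
    'cV[R]_n :=
  x + map_mx intr (B *m u) - map_mx intr (D *m w).

                                                                          
                                                                            
                 
Definition robustly_control_invariant (X : set 'cV[R]_n) : Prop :=
  exists2 phi : 'cV[R]_n -> 'cV[int]_m, set_fun X (@vectors_in U m) phi &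
    forall x w, X x -> vectors_in W w -> X (next_state x (phi x) w).

                                                                          
                                                                          
            
Definition robustly_globally_attractive (X : set 'cV[R]_n) : Prop :=
  exists2 psi : 'cV[R]_n -> 'cV[int]_m, set_fun (~` X) (@vectors_in U m) psi &
    forall (w : nat -> 'cV[int]_p) (x : nat -> 'cV[R]_n),
      (forall t, vectors_in W (w t)) ->
      (~` X) (x 0%N) ->
      (forall t, (~` X) (x t) -> x t.+1 = next_state (x t) (psi (x t)) (w t)) ->
      exists tau, X (x tau).

End System.

(* Main.v *)
Require Import Defs.
From mathcomp Require Import all_boot all_order all_algebra.
From mathcomp Require Import finmap.
From mathcomp Require Import classical_sets functions reals.
From mathcomp Require Import boolp.
From mathcomp Require Import lra.

Set Implicit Arguments.
Unset Strict Implicit.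
Unset Printing Implicit Defensive.

Import Order.TTheory GRing.Theory Num.Theory.

Local Open Scope classical_set_scope.
Local Open Scope ring_scope.

(** Since [U] and [W] are finite, every one-step displacement [B u - D w] is
    bounded componentwise by a single integer [c].  The hypothesis lets the
    controller prescribe the sign of every component of the displacement at
    once, against all disturbances, and an integer of prescribed strict sign
    has absolute value at least 1.

    So take the threshold feedback which pushes the component [x_i] up when
    [x_i <= c] and down when [x_i > c].  Each component then evolves by itself:
    from below the threshold it climbs by an amount in [1, c], hence lands at
    2c at most; from above it descends by an amount in [1, c], hence stays
    positive.  Consequently, this feedback sends the enlarged box
    [-e - 1, 2c + e + 1]^n into [-e, 2c + e]^n, for every real e >= 0
    ([threshold_step_shrinks]).

    This contraction gives both properties of the hyperbox X = [0, 2c]^n: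
    with e = 0, X lies in the enlarged box and so is mapped into itself; and
    a state in [-k, 2c + k]^n with k a natural number reaches X within k
    steps, where every initial state lies in such a box. *)

Lemma fset_int_bounded (S : {fset int}) :
  exists a : int, forall v, v \in S -> `|v| <= a.
Proof.
exists (\sum_(v <- enum_fset S) `|v|) => v vS.
by rewrite (big_rem v) //= lerDl sumr_ge0.
Qed.

Lemma mulmx_vectors_in_bounded (n k : nat) (A : 'M[int]_(n, k))
    (S : {fset int}) :
  exists c : int, forall v, vectors_in S v ->
    forall i, `|(A *m v) i ord0| <= c.
Proof.
have [a aP] := fset_int_bounded S.
exists (\sum_i \sum_j `|A i j| * `|a|) => v vS i.
have rowP : `|(A *m v) i ord0| <= \sum_j `|A i j| * `|a|.
  rewrite mxE (le_trans (ler_norm_sum _ _ _)) // ler_sum // => j _.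
  by rewrite normrM ler_wpM2l // (le_trans (aP _ (vS j))) ?ler_norm.
rewrite (bigD1 i) //= (le_trans rowP) // lerDl.
by apply: sumr_ge0 => l _; apply: sumr_ge0 => j _; rewrite mulr_ge0.
Qed.

Lemma displacement_bounded (n m p : nat) (U W : {fset int})
    (B : 'M[int]_(n, m)) (D : 'M[int]_(n, p)) :
  exists c : int, forall u w, vectors_in U u -> vectors_in W w ->
    forall i, `|(B *m u - D *m w) i ord0| <= c.
Proof.
have [b bP] := mulmx_vectors_in_bounded B U.
have [d dP] := mulmx_vectors_in_bounded D W.
exists (b + d) => u w uU wW i.
rewrite mxE [X in _ + X]mxE (le_trans (ler_normB _ _)) // lerD //.
- exact: bP.
- exact: dP.
Qed.

Definition enlarged_box (R : realType) (n : nat) (c e : R) : set 'cV[R]_n :=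
  [set x | forall i, - e <= x i ord0 <= c + c + e].

Lemma enlarged_box_le (R : realType) (n : nat) (c e e' : R) :
  e <= e' -> @enlarged_box R n c e `<=` enlarged_box c e'.
Proof. by move=> ee' x xE i; have := xE i; lra. Qed.

Lemma enlarged_box_exhaust (R : realType) (n : nat) (c : R) (x : 'cV[R]_n) :
  0 <= c -> exists k : nat, enlarged_box c k%:R x.
Proof.
move=> c0; set s := \sum_i `|x i ord0|.
have s0 : 0 <= s by apply: sumr_ge0.
exists (Num.bound s) => i; have sk := archi_boundP s0.
have : `|x i ord0| <= s by rewrite /s (bigD1 i) //= lerDl sumr_ge0.
by rewrite ler_norml; lra.
Qed.

Section ThresholdFeedback.
Variables (R : realType) (n m p : nat) (U W : {fset int}).
Variables (B : 'M[int]_(n, m)) (D : 'M[int]_(n, p)).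

(** The sign pattern of the threshold feedback is carried by a binary vector,
    the form in which the nonemptiness hypothesis can be applied. *)
Definition threshold (c : R) (x : 'cV[R]_n) : 'cV[R]_n :=
  \col_i (if x i ord0 <= c then 0 else 1).

Lemma threshold_binary (c : R) (x : 'cV[R]_n) : binary_vectors (threshold c x).
Proof. by move=> i; rewrite mxE; case: ifP => _; [left | right]. Qed.

Lemma Ustar_of_vectors_in (z : 'cV[R]_n) (u : 'cV[int]_m) :
  (0 < n)%N -> Ustar_of U W B D z u -> vectors_in U u.
Proof.
by move=> n0 /(_ (Ordinal n0) I); case: (signature z _) => -[].
Qed.

(** Strictly signed integers are at least 1 in absolute value: this uniform
    gap is what makes the progress per step bounded away from 0. *)
Lemma threshold_displacement (c : R) (x : 'cV[R]_n) u w i :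
  Ustar_of U W B D (threshold c x) u -> vectors_in W w ->
  let d := ((B *m u - D *m w) i ord0)%:~R : R in
  if x i ord0 <= c then 1 <= d else d <= -1.
Proof.
move=> /(_ i I) + wW; rewrite /signature mxE.
case: (_ <= c); rewrite ?eqxx ?oner_eq0 /= => -[_ /(_ w wW)].
- by rewrite ler1z gtz0_ge1.
- by rewrite -oppr_gt0 gtz0_ge1 lerNr -(ler_int R) rmorphN1.
Qed.

(** Below the threshold the danger is only to overshoot [2c], above it only
    to undershoot [0]; the bound [c] on the displacement excludes both, and
    the gap of 1 absorbs the excess. *)
Lemma threshold_step_shrinks (c : int) (e : R) (x : 'cV[R]_n) u w :
  (forall i, `|(B *m u - D *m w) i ord0| <= c) ->
  Ustar_of U W B D (threshold c%:~R x) u -> vectors_in W w -> 0 <= e ->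
  enlarged_box c%:~R (e + 1) x ->
  enlarged_box c%:~R e (next_state B D x u w).
Proof.
move=> dc ux wW e0 xE i.
have := threshold_displacement i ux wW; have := xE i.
have -> : next_state B D x u w i ord0
        = x i ord0 + ((B *m u - D *m w) i ord0)%:~R.
  by rewrite /next_state -addrA -map_mxB mxE [X in _ + X]mxE.
have : `|((B *m u - D *m w) i ord0)%:~R : R| <= c%:~R.
  by rewrite -intr_norm ler_int.
rewrite ler_norml /=; case: (leP (x i ord0) c%:~R); lra.
Qed.

End ThresholdFeedback.

Theorem theorem2 (R : realType) (n m p : nat)
    (hn : (0 < n)%N) (hm : (0 < m)%N) (hp : (0 < p)%N)
    (U W : {fset int}) (hU : U != fset0) (hW : W != fset0)
    (B : 'M[int]_(n, m)) (D : 'M[int]_(n, p))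
    (hUstar : forall z : 'cV[R]_n,
      binary_vectors z -> Ustar_of U W B D z !=set0) :
  exists X : set 'cV[R]_n,
    [/\ is_hyperbox X,
        robustly_control_invariant U W B D X &
        robustly_globally_attractive U W B D X].
Proof.
have [c0 c0P] := displacement_bounded U W B D.
pose c := `|c0|; pose r : R := c%:~R.
have cP u w : vectors_in U u -> vectors_in W w ->
    forall i, `|(B *m u - D *m w) i ord0| <= c.
  by move=> uU wW i; rewrite (le_trans (c0P u w uU wW i)) ?ler_norm.
have r0 : 0 <= r by rewrite ler0z normr_ge0.
have /choice[phi phiP] (x : 'cV[R]_n) :
    exists u, Ustar_of U W B D (threshold r x) u.
  exact/hUstar/threshold_binary.
have phiU x : vectors_in U (phi x) := Ustar_of_vectors_in hn (phiP x).
have step x w e : vectors_in W w -> 0 <= e -> enlarged_box r (e + 1) x ->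
    enlarged_box r e (next_state B D x (phi x) w).
  by move=> wW; apply: threshold_step_shrinks => //; exact: cP.
exists (enlarged_box r 0); split.
- exists (const_mx (r + r)) => [i|]; first by rewrite mxE addr_ge0.
  by apply/seteqP; split=> x /= xE i; have := xE i; rewrite !mxE oppr0 addr0.
- exists phi => [x _|x w xX wW]; first exact: phiU.
  by apply: step => //; apply: enlarged_box_le xX; rewrite add0r.
- exists phi => [x _|w x wW _ dyn]; first exact: phiU.
  have [k] := enlarged_box_exhaust (x 0%N) r0.
  elim: k 0%N => [t xE|k IH t xE]; first by exists t.
  have [xX|xX] := pselect (enlarged_box r 0 (x t)); first by exists t.
  by apply: (IH t.+1); rewrite dyn //; apply: step; rewrite // natr1.
Qed.
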